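(* Every semi-C-reducible twisted product Finsler manifold $(M_1\times_f M_2,F)$ is a $C2$-like manifold.
   Context: A Finsler metric is a function on the tangent bundle, smooth on the slit tangent bundle, positively 1-homogeneous on fibres, with positive definite fundamental tensor. Let $(M_1,F_1)$, $(M_2,F_2)$ be Finsler manifolds of dimensions $n_1,n_2$ and $f:M_1\times M_2\to\mathbb{R}^+$ smooth. The twisted product $M_1\times_f M_2$ is $M=M_1\times M_2$, $n=n_1+n_2$, with $F=\sqrt{F_1^2(x,y)+f^2(x,u)F_2^2(u,v)}$, considered at points with $y\in T_xM_1$, $v\in T_uM_2$, $y\ne0$, $v\ne 0$. Local coordinates are $\mathbf{x}^a=(x^i,u^\alpha)$ with fibre coordinates $\mathbf{y}^a=(y^i,v^\alpha)$. Put $\mathbf g_{ab}=\frac12\frac{\partial^2F^2}{\partial\mathbf y^a\partial\mathbf y^b}$, $\mathbf y_a=\mathbf g_{ab}\mathbf y^b$, $\mathbf C_{abc}=\frac12\frac{\partial \mathbf g_{ab}}{\partial\mathbf y^c}$, $\mathbf I_a=\mathbf g^{bc}\mathbf C_{abc}$, $\mathbf h_{ab}=\mathbf g_{ab}-\frac1{F^2}\mathbf y_a\mathbf y_b$, $\mathbf C^2=\mathbf g^{ab}\mathbf I_a\mathbf I_b$. $F$ is semi-C-reducible if $\mathbf C^2\neq0$ (so that the following formula makes sense; in particular $F$ is non-Riemannian) and there are scalar functions $p,q$ of $(\mathbf x,\mathbf y)$ with $p+q=1$ such that $$\mathbf C_{abc}=\frac{p}{n+1}\{\mathbf I_a\mathbf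 h_{bc}+\mathbf I_b\mathbf h_{ac}+\mathbf I_c\mathbf h_{ab}\}+\frac{q}{\mathbf C^2}\mathbf I_a\mathbf I_b\mathbf I_c .$$ $F$ is $C2$-like if this holds with $p=0$, i.e. $\mathbf C_{abc}=\frac{1}{\mathbf C^2}\mathbf I_a\mathbf I_b\mathbf I_c$. *)

(* Defs.v *)
From HB Require Import structures.
From mathcomp Require Import all_boot all_order all_algebra.
From mathcomp Require Import all_classical all_reals all_analysis.

Set Implicit Arguments.
Unset Strict Implicit.
Unset Printing Implicit Defensive.

Import Order.TTheory GRing.Theory Num.Theory.
Import numFieldNormedType.Exports.

Local Open Scope classical_set_scope.
Local Open Scope ring_scope.

Definition partial (R : realType) (n : nat) (i : 'I_n)
    (f : 'rV[R]_n -> R) : 'rV[R]_n -> R :=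
  'D_(delta_mx 0 i) f.

Fixpoint Ck_on (R : realType) (n : nat) (k : nat) (U : set 'rV[R]_n)
    (f : 'rV[R]_n -> R) : Prop :=
  (forall x, U x -> {for x, continuous f}) /\
  match k with
  | 0 => True
  | k'.+1 => forall i : 'I_n,
      (forall x, U x -> derivable f x (delta_mx 0 i)) /\
      Ck_on k' U (partial i f)
  end.

(* Only meaningful for open U. *)
Definition smooth_on (R : realType) (n : nat) (U : set 'rV[R]_n)
    (f : 'rV[R]_n -> R) : Prop :=
  forall k, Ck_on k U f.

(* A smooth manifold is given by an atlas, not necessarily maximal. The maps
   coord c and inv c are total; their values off dom c, resp. off
   coord c @` dom c, are irrelevant. *)
Record manifold (R : realType) (n : nat) : Type := Manifold {
  pt :> topologicalType ;
  chart : Type ;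
  dom : chart -> set pt ;
  coord : chart -> pt -> 'rV[R]_n ;
  inv : chart -> 'rV[R]_n -> pt ;
  manifold_hausdorff : hausdorff_space pt ;
  manifold_second_countable : @second_countable pt ;
  dom_open : forall c, open (dom c) ;
  dom_cover : forall x, exists c, dom c x ;
  coordK : forall c x, dom c x -> inv c (coord c x) = x ;
  image_open : forall c, open (coord c @` dom c) ;
  coord_cont : forall c x, dom c x -> {for x, continuous (coord c)} ;
  inv_cont : forall c z, (coord c @` dom c) z -> {for z, continuous (inv c)} ;
  transition_smooth : forall c c' j,
    smooth_on (coord c @` (dom c `&` dom c'))
      (fun z => coord c' (inv c z) 0 j)
}.

Definition smooth_fun (R : realType) (n : nat) (M : manifold R n)
    (f : M -> R) : Prop :=
  forall c : chart M, smooth_on (coord c @` dom c) (fun z => f (inv c z)).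

(* y *m jac c c' x are the coordinates in c' of the tangent vector at x whose
   coordinates in c are y: y'^j = sum_i y^i dx'^j/dx^i. *)
Definition jac (R : realType) (n : nat) (M : manifold R n) (c c' : chart M)
    (x : M) : 'M[R]_n :=
  \matrix_(i, j) partial i (fun z => coord c' (inv c z) 0 j) (coord c x).

(* Functions on TM, where TM is glued from the sets {(c, x, y) | x in dom c}
   along (c, x, y) ~ (c', x, y *m jac c c' x): F c x y is the value of F at the
   tangent vector at x with coordinates y in c, and is irrelevant when x is not
   in dom c. *)
Record tangent_fun (R : realType) (n : nat) (M : manifold R n) : Type :=
  TangentFun {
    tangent_val :> chart M -> M -> 'rV[R]_n -> R ;
    tangent_valE : forall c c' x y, dom c x -> dom c' x ->
      tangent_val c' x (y *m jac c c' x) = tangent_val c x y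
  }.

Section FibreTensors.
Variables (R : realType) (n : nat) (L : 'rV[R]_n -> R) (y : 'rV[R]_n).

Definition fundamental_tensor : 'M[R]_n :=
  \matrix_(a, b) (2^-1 * partial a (partial b (fun w => L w ^+ 2)) y).

Definition covector (a : 'I_n) : R :=
  \sum_b fundamental_tensor a b * y 0 b.

End FibreTensors.

Section CartanTensors.
Variables (R : realType) (n : nat) (L : 'rV[R]_n -> R) (y : 'rV[R]_n).

Let g := fundamental_tensor L y.

Definition cartan_tensor (a b c : 'I_n) : R :=
  2^-1 * partial c (fun w => fundamental_tensor L w a b) y.

Definition mean_cartan (a : 'I_n) : R :=
  \sum_b \sum_c invmx g b c * cartan_tensor a b c.

Definition angular_metric (a b : 'I_n) : R :=
  g a b - (L y ^+ 2)^-1 * (covector L y a * covector L y b).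

Definition mean_cartan_sq : R :=
  \sum_a \sum_b invmx g a b * (mean_cartan a * mean_cartan b).

End CartanTensors.

Definition finsler_metric (R : realType) (n : nat) (M : manifold R n)
    (F : tangent_fun M) : Prop :=
  [/\ forall c : chart M,
        smooth_on
          [set w : 'rV[R]_(n + n) |
            (coord c @` dom c) (lsubmx w) /\ rsubmx w != 0]
          (fun w => F c (inv c (lsubmx w)) (rsubmx w)),
      forall (c : chart M) x (y : 'rV[R]_n) (l : R), dom c x -> 0 < l ->
        F c x (l *: y) = l * F c x y
    & forall (c : chart M) x (y w : 'rV[R]_n), dom c x -> y != 0 -> w != 0 ->
        0 < (w *m fundamental_tensor (F c x) y *m w^T) 0 0].

(* F is considered on the set A of tangent vectors: A c x y means that the
   tangent vector at x with coordinates y in c is in A. A is kept general since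
   C^2 always vanishes somewhere on the set of all (y, v) with y != 0 and
   v != 0 of a product: I_a = d(log sqrt(det g))/dy^a, det g is 0-homogeneous in
   y and in v separately, hence has a critical point. *)
Definition semi_C_reducible_on (R : realType) (n : nat) (M : manifold R n)
    (A : chart M -> M -> set 'rV[R]_n) (F : tangent_fun M) : Prop :=
  (forall (c : chart M) x y, dom c x -> A c x y ->
     mean_cartan_sq (F c x) y != 0) /\
  exists p q : tangent_fun M,
    forall (c : chart M) x y, dom c x -> A c x y ->
      p c x y + q c x y = 1 /\
      forall i j k : 'I_n,
        let I_ := mean_cartan (F c x) y in
        let h_ := angular_metric (F c x) y in
        cartan_tensor (F c x) y i j k =
          p c x y / (n.+1)%:R * (I_ i * h_ j k + I_ j * h_ i k + I_ k * h_ i j)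
          + q c x y / mean_cartan_sq (F c x) y * (I_ i * I_ j * I_ k).

Definition C2_like_on (R : realType) (n : nat) (M : manifold R n)
    (A : chart M -> M -> set 'rV[R]_n) (F : tangent_fun M) : Prop :=
  forall (c : chart M) x y, dom c x -> A c x y ->
    mean_cartan_sq (F c x) y != 0 /\
    forall i j k : 'I_n,
      let I_ := mean_cartan (F c x) y in
      cartan_tensor (F c x) y i j k =
        (mean_cartan_sq (F c x) y)^-1 * (I_ i * I_ j * I_ k).

Section SmoothProj.
Variable (R : realType).

Lemma Ck_on_sub n k (U V : set 'rV[R]_n) f :
  V `<=` U -> Ck_on k U f -> Ck_on k V f.
Proof.
move=> sVU; elim: k f => [|k IH] f /= [cf df]; split=> //.
- by move=> x /sVU; exact: cf.
- by move=> x /sVU; exact: cf.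
- by move=> i; have [di Ci] := df i; split=> [x /sVU|]; [exact: di|exact: IH].
Qed.

Lemma Ck_on_cst n k (U : set 'rV[R]_n) (a : R) : Ck_on k U (fun=> a).
Proof.
elim: k a => [|k IH] a /=; split=> //.
- by move=> x _; exact: cst_continuous.
- by move=> x _; exact: cst_continuous.
move=> i; split=> [x _|]; first exact: derivable_cst.
have -> : partial i (fun=> a) = fun=> 0 :> R.
  by apply/funext => x; rewrite /partial derive_cst.
exact: IH.
Qed.

Lemma lsub_delta_l n1 n2 (i : 'I_n1) :
  lsubmx (delta_mx 0 (lshift n2 i) : 'rV[R]__) = delta_mx 0 i.
Proof. by apply/rowP => j; rewrite !mxE (inj_eq (@lshift_inj _ _)). Qed.

Lemma lsub_delta_r n1 n2 (i : 'I_n2) :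
  lsubmx (delta_mx 0 (rshift n1 i) : 'rV[R]__) = 0.
Proof. by apply/rowP => j; rewrite !mxE eq_lrshift andbF. Qed.

Lemma rsub_delta_r n1 n2 (i : 'I_n2) :
  rsubmx (delta_mx 0 (rshift n1 i) : 'rV[R]__) = delta_mx 0 i.
Proof. by apply/rowP => j; rewrite !mxE (inj_eq (@rshift_inj _ _)). Qed.

Lemma rsub_delta_l n1 n2 (i : 'I_n1) :
  rsubmx (delta_mx 0 (lshift n2 i) : 'rV[R]__) = 0.
Proof. by apply/rowP => j; rewrite !mxE eq_rlshift andbF. Qed.

Section Additive.
Variables (n m : nat) (pi : {linear 'rV[R]_n -> 'rV[R]_m}).

Let quotE (f : 'rV[R]_m -> R) (x v : 'rV[R]_n) :
  (fun h : R => h^-1 *: (((f \o pi) \o shift x) (h *: v) - (f \o pi) x)) =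
  (fun h : R => h^-1 *: ((f \o shift (pi x)) (h *: pi v) - f (pi x))).
Proof. by apply/funext => h /=; rewrite linearP. Qed.

Lemma derive_lin (f : 'rV[R]_m -> R) (x v : 'rV[R]_n) :
  'D_v (f \o pi) x = 'D_(pi v) f (pi x).
Proof. by rewrite /derive quotE. Qed.

Lemma derivable_lin (f : 'rV[R]_m -> R) (x v : 'rV[R]_n) :
  derivable f (pi x) (pi v) -> derivable (f \o pi) x v.
Proof. by rewrite /derivable quotE. Qed.

End Additive.

Lemma derivable0 n (f : 'rV[R]_n -> R) x : derivable f x 0.
Proof.
rewrite /derivable.
rewrite (_ : (fun h : R => _) = fun=> 0); first exact: is_cvg_cst.
by apply/funext => h /=; rewrite scaler0 add0r subrr scaler0.
Qed.

Lemma derive0 n (f : 'rV[R]_n -> R) x : 'D_0 f x = 0.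
Proof.
rewrite /derive.
rewrite (_ : (fun h : R => _) = fun=> 0); first exact: lim_cst.
by apply/funext => h /=; rewrite scaler0 add0r subrr scaler0.
Qed.

Lemma partial_lsub_l n1 n2 (f : 'rV[R]_n1 -> R) (i : 'I_n1) :
  partial (lshift n2 i) (fun z => f (lsubmx z)) =
  (fun z => partial i f (lsubmx z)).
Proof. by apply/funext => z; rewrite /partial (derive_lin lsubmx) /= lsub_delta_l. Qed.

Lemma partial_lsub_r n1 n2 (f : 'rV[R]_n1 -> R) (i : 'I_n2) :
  partial (rshift n1 i) (fun z => f (lsubmx z)) = fun=> 0.
Proof.
by apply/funext => z; rewrite /partial (derive_lin lsubmx) /= lsub_delta_r derive0.
Qed.

Lemma partial_rsub_r n1 n2 (f : 'rV[R]_n2 -> R) (i : 'I_n2) :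
  partial (rshift n1 i) (fun z => f (rsubmx z)) =
  (fun z => partial i f (rsubmx z)).
Proof. by apply/funext => z; rewrite /partial (derive_lin rsubmx) /= rsub_delta_r. Qed.

Lemma partial_rsub_l n1 n2 (f : 'rV[R]_n2 -> R) (i : 'I_n1) :
  partial (lshift n2 i) (fun z => f (rsubmx z)) = fun=> 0.
Proof.
by apply/funext => z; rewrite /partial (derive_lin rsubmx) /= rsub_delta_l derive0.
Qed.

Lemma Ck_on_lsub n1 n2 k (U : set 'rV[R]_n1) f : Ck_on k U f ->
  Ck_on k [set z : 'rV[R]_(n1 + n2) | U (lsubmx z)] (fun z => f (lsubmx z)).
Proof.
elim: k f => [|k IH] f /= [cf df].
all: have cf' (x : 'rV[R]_(n1 + n2)) : U (lsubmx x) ->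
    {for x, continuous (fun z => f (lsubmx z))} by
  move=> Ux; apply: continuous_comp; [exact: continuous_lsubmx|exact: cf].
  by split.
split=> // i; case: (split_ordP i) => {}i ->.
- have [di Ci] := df i; rewrite partial_lsub_l; split; last exact: IH.
  move=> x Ux; apply: (derivable_lin (pi := lsubmx)) => /=.
  by rewrite lsub_delta_l; exact: di.
- rewrite partial_lsub_r; split; last exact: Ck_on_cst.
  move=> x Ux; apply: (derivable_lin (pi := lsubmx)) => /=.
  by rewrite lsub_delta_r; exact: derivable0.
Qed.

Lemma Ck_on_rsub n1 n2 k (U : set 'rV[R]_n2) f : Ck_on k U f ->
  Ck_on k [set z : 'rV[R]_(n1 + n2) | U (rsubmx z)] (fun z => f (rsubmx z)).
Proof.
elim: k f => [|k IH] f /= [cf df].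
all: have cf' (x : 'rV[R]_(n1 + n2)) : U (rsubmx x) ->
    {for x, continuous (fun z => f (rsubmx z))} by
  move=> Ux; apply: continuous_comp; [exact: continuous_rsubmx|exact: cf].
  by split.
split=> // i; case: (split_ordP i) => {}i ->.
- rewrite partial_rsub_l; split; last exact: Ck_on_cst.
  move=> x Ux; apply: (derivable_lin (pi := rsubmx)) => /=.
  by rewrite rsub_delta_l; exact: derivable0.
- have [di Ci] := df i; rewrite partial_rsub_r; split; last exact: IH.
  move=> x Ux; apply: (derivable_lin (pi := rsubmx)) => /=.
  by rewrite rsub_delta_r; exact: di.
Qed.

End SmoothProj.

Section ProdTopology.
Variables (T U : topologicalType).

Lemma hausdorff_prod :
  hausdorff_space T -> hausdorff_space U -> hausdorff_space (T * U)%type.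
Proof.
move=> hT hU [x1 x2] [y1 y2] cl; congr pair.
- apply: hT => A B nA nB.
  have [||[z1 z2] [[]]] := cl (A `*` setT) (B `*` setT).
  + by exists (A, setT) => //=; split=> //; exact: filterT.
  + by exists (B, setT) => //=; split=> //; exact: filterT.
  + by move=> /= Az _ [/= Bz _]; exists z1.
- apply: hU => A B nA nB.
  have [||[z1 z2] [[]]] := cl (setT `*` A) (setT `*` B).
  + by exists (setT, A) => //=; split=> //; exact: filterT.
  + by exists (setT, B) => //=; split=> //; exact: filterT.
  + by move=> /= _ Az [/= _ Bz]; exists z2.
Qed.

Lemma open_setX (A : set T) (B : set U) : open A -> open B -> open (A `*` B).
Proof.
rewrite !openE => oA oB [x y] [/= Ax By].
by exists (A, B) => //=; split; [exact: oA|exact: oB].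
Qed.

Lemma second_countable_prod :
  @second_countable T -> @second_countable U ->
  @second_countable (T * U)%type.
Proof.
move=> [B cB [oB nB]] [C cC [oC nC]].
exists [set A.1 `*` A.2 | A in B `*` C].
  exact: (card_le_trans (card_image_le _ _) (countableX cB cC)).
split=> [_ [[V W] [/= BV CW] <-]|[x y] D [[P Q] [/= Px Qy] PQD]].
  exact: open_setX (oB _ BV) (oC _ CW).
have [V [/= BV Vx] VP] := nB x P Px; have [W [/= CW Wy] WQ] := nC y Q Qy.
exists (V `*` W); first by split=> //; exists (V, W).
by move=> [a b] [/= Va Wb]; apply: PQD; split; [exact: VP|exact: WQ].
Qed.

End ProdTopology.

Section ProdManifold.
Variables (R : realType) (n1 n2 : nat) (M1 : manifold R n1) (M2 : manifold R n2).

Definition prod_dom (c : chart M1 * chart M2) : set (M1 * M2) :=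
  dom c.1 `*` dom c.2.

Definition prod_coord (c : chart M1 * chart M2) (x : M1 * M2) :
    'rV[R]_(n1 + n2) :=
  row_mx (coord c.1 x.1) (coord c.2 x.2).

Definition prod_inv (c : chart M1 * chart M2) (z : 'rV[R]_(n1 + n2)) :
    M1 * M2 :=
  (inv c.1 (lsubmx z), inv c.2 (rsubmx z)).

Lemma prod_hausdorff : hausdorff_space (M1 * M2)%type.
Proof. by apply: hausdorff_prod; exact: manifold_hausdorff. Qed.

Lemma prod_second_countable : @second_countable (M1 * M2)%type.
Proof. by apply: second_countable_prod; exact: manifold_second_countable. Qed.

Lemma prod_dom_open c : open (prod_dom c).
Proof. by apply: open_setX; exact: dom_open. Qed.

Lemma prod_dom_cover x : exists c, prod_dom c x.
Proof.
have [c1 d1] := dom_cover x.1; have [c2 d2] := dom_cover x.2.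
by exists (c1, c2).
Qed.

Lemma prod_coordK c x : prod_dom c x -> prod_inv c (prod_coord c x) = x.
Proof.
case: x => x1 x2 [/= d1 d2].
by rewrite /prod_inv /prod_coord row_mxKl row_mxKr !coordK.
Qed.

Lemma prod_imageE c : prod_coord c @` prod_dom c =
  [set z | (coord c.1 @` dom c.1) (lsubmx z) /\
           (coord c.2 @` dom c.2) (rsubmx z)].
Proof.
apply/seteqP; split=> [_ [[x1 x2] [/= d1 d2] <-]|z [[x1 d1 e1] [x2 d2 e2]]].
  by rewrite /prod_coord /= row_mxKl row_mxKr; split; [exists x1|exists x2].
by exists (x1, x2) => //; rewrite /prod_coord /= e1 e2 hsubmxK.
Qed.

Lemma prod_image_open c : open (prod_coord c @` prod_dom c).
Proof.
rewrite prod_imageE; apply: openI.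
- apply: (open_comp (f := lsubmx)); last exact: image_open.
  by move=> z _; exact: continuous_lsubmx.
- apply: (open_comp (f := rsubmx)); last exact: image_open.
  by move=> z _; exact: continuous_rsubmx.
Qed.

Lemma prod_coord_cont c x : prod_dom c x -> {for x, continuous (prod_coord c)}.
Proof.
case: x => x1 x2 [/= d1 d2] A [P nP sPA].
have n1P := coord_cont d1; have n2P := coord_cont d2.
exists (coord c.1 @^-1` [set w | forall i j, P i (lshift n2 j) (w i j)],
        coord c.2 @^-1` [set w | forall i j, P i (rshift n1 j) (w i j)]).
  split=> /=.
  - apply: n1P; exists (fun i j => P i (lshift n2 j)) => // i j.
    by have := nP i (lshift n2 j); rewrite /prod_coord row_mxEl.
  - apply: n2P; exists (fun i j => P i (rshift n1 j)) => // i j.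
    by have := nP i (rshift n1 j); rewrite /prod_coord row_mxEr.
move=> [a b] [/= Pa Pb]; apply: sPA => i j.
rewrite /prod_coord; case: (split_ordP j) => {}j ->.
- by rewrite row_mxEl.
- by rewrite row_mxEr.
Qed.

Lemma prod_inv_cont c z :
  (prod_coord c @` prod_dom c) z -> {for z, continuous (prod_inv c)}.
Proof.
rewrite prod_imageE => -[z1 z2].
have h1 : {for z, continuous (fun w => inv c.1 (lsubmx w))}.
  by apply: continuous_comp; [exact: continuous_lsubmx|exact: inv_cont].
have h2 : {for z, continuous (fun w => inv c.2 (rsubmx w))}.
  by apply: continuous_comp; [exact: continuous_rsubmx|exact: inv_cont].
exact: cvg_pair h1 h2.
Qed.

Lemma prod_transition_l c c' (j : 'I_n1) :
  (fun z => prod_coord c' (prod_inv c z) 0 (lshift n2 j)) =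
  (fun z => coord c'.1 (inv c.1 (lsubmx z)) 0 j).
Proof. by apply/funext => z; rewrite /prod_coord row_mxEl. Qed.

Lemma prod_transition_r c c' (j : 'I_n2) :
  (fun z => prod_coord c' (prod_inv c z) 0 (rshift n1 j)) =
  (fun z => coord c'.2 (inv c.2 (rsubmx z)) 0 j).
Proof. by apply/funext => z; rewrite /prod_coord row_mxEr. Qed.

Lemma prod_transition_smooth c c' j :
  smooth_on (prod_coord c @` (prod_dom c `&` prod_dom c'))
    (fun z => prod_coord c' (prod_inv c z) 0 j).
Proof.
move=> k; case: (split_ordP j) => {}j ->.
- rewrite prod_transition_l.
  apply: Ck_on_sub; last exact: Ck_on_lsub (transition_smooth c.1 c'.1 j k).
  move=> _ [[x1 x2] [[/= d1 d2] [/= d1' d2']] <-] /=.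
  by rewrite /prod_coord row_mxKl; exists x1.
- rewrite prod_transition_r.
  apply: Ck_on_sub; last exact: Ck_on_rsub (transition_smooth c.2 c'.2 j k).
  move=> _ [[x1 x2] [[/= d1 d2] [/= d1' d2']] <-] /=.
  by rewrite /prod_coord row_mxKr; exists x2.
Qed.

Definition prod_manifold : manifold R (n1 + n2) :=
  Manifold prod_hausdorff prod_second_countable prod_dom_open prod_dom_cover
    prod_coordK prod_image_open prod_coord_cont prod_inv_cont
    prod_transition_smooth.

Lemma prod_jac (c c' : chart prod_manifold) (x : prod_manifold) :
  jac c c' x = block_mx (jac c.1 c'.1 x.1) 0 0 (jac c.2 c'.2 x.2).
Proof.
apply/matrixP => i j.
case: (split_ordP i) => {}i ->; case: (split_ordP j) => {}j ->.
- rewrite block_mxEul !mxE prod_transition_l.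
  rewrite (partial_lsub_l n2 (fun w => coord c'.1 (inv c.1 w) 0 j)).
  by rewrite /= /prod_coord row_mxKl.
- rewrite block_mxEur !mxE prod_transition_r.
  by rewrite (partial_rsub_l (fun w => coord c'.2 (inv c.2 w) 0 j)).
- rewrite block_mxEdl !mxE prod_transition_l.
  by rewrite (partial_lsub_r (fun w => coord c'.1 (inv c.1 w) 0 j)).
- rewrite block_mxEdr !mxE prod_transition_r.
  rewrite (partial_rsub_r n1 (fun w => coord c'.2 (inv c.2 w) 0 j)).
  by rewrite /= /prod_coord row_mxKr.
Qed.

Variables (F1 : tangent_fun M1) (F2 : tangent_fun M2).
Variable (f : prod_manifold -> R).

Definition twisted_val (c : chart prod_manifold) (x : prod_manifold)
    (Y : 'rV[R]_(n1 + n2)) : R :=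
  Num.sqrt (F1 c.1 x.1 (lsubmx Y) ^+ 2 +
            f x ^+ 2 * F2 c.2 x.2 (rsubmx Y) ^+ 2).

Lemma twisted_valE (c c' : chart prod_manifold) (x : prod_manifold) Y :
  dom c x -> dom c' x -> twisted_val c' x (Y *m jac c c' x) = twisted_val c x Y.
Proof.
move=> [d1 d2] [d1' d2']; rewrite /twisted_val prod_jac -{1 2}[Y]hsubmxK.
rewrite mul_row_block !mulmx0 addr0 add0r row_mxKl row_mxKr.
by rewrite !tangent_valE.
Qed.

Definition twisted_metric : tangent_fun prod_manifold :=
  TangentFun twisted_valE.

End ProdManifold.

(* The tangent vectors (y, v) of M1 x M2 with y != 0 and v != 0. *)
Definition split_slit (R : realType) (n1 n2 : nat) : set 'rV[R]_(n1 + n2) :=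
  [set Y | lsubmx Y != 0 /\ rsubmx Y != 0].
Arguments split_slit {R n1 n2}.

(* Main.v *)
(* At a fixed base point F^2 is a sum of a function of y and a function of v, so
   g is block diagonal and every mixed component of C vanishes. Euler's theorem
   gives C_abc y^a = 0 on the first block, hence I_i y^i = 0, and likewise on the
   second. Contracting the semi-C-reducibility formula at indices (i, j, alpha)
   with y^i y^j leaves p I_alpha F1^2 f^2 F2^2 / F^2 = 0, and symmetrically
   p I_i = 0. As C^2 != 0, some component of I is nonzero, so p = 0. *)
Require Import Defs.
From mathcomp Require Import all_boot all_order all_algebra.
From mathcomp Require Import all_classical all_reals all_analysis.
From mathcomp Require Import ring.
Import Order.TTheory GRing.Theory Num.Theory.
Import numFieldNormedType.Exports.
Set Implicit Arguments.
Unset Strict Implicit.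
Unset Printing Implicit Defensive.
Local Open Scope classical_set_scope.
Local Open Scope ring_scope.

(** * Directional derivatives and their additivity in the direction *)

Section DirectionalDerivative.
Variables (R : realType) (V : normedModType R).

(** Both difference quotients are the same function of [h]; this brings in one-variable calculus, in
    particular the mean value theorem. *)
Lemma is_derive_line (f : V -> R) (w e : V) (t : R) :
  derivable f (w + t *: e) e ->
  is_derive t 1 (fun s : R => f (w + s *: e)) ('D_e f (w + t *: e)).
Proof.
move=> df.
have E : (fun h : R => h^-1 *: (((fun s => f (w + s *: e)) \o shift t) (h *: 1)
                               - f (w + t *: e))) =
         (fun h : R => h^-1 *: ((f \o shift (w + t *: e)) (h *: e)
                               - f (w + t *: e))).
  by apply/funext => h /=; rewrite /shift /= [h *: 1]mulr1 scalerDl addrCA.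
by split; rewrite /derivable /derive E.
Qed.

(** By the mean value theorem on the line through [w], the increment is [s] times a value of the
    derivative, and that value is within [eps] of [d]. *)
Lemma derive_mean_value_le (f : V -> R) (w e : V) (s d eps : R) :
  (forall t : R, `|t| <= `|s| -> derivable f (w + t *: e) e) ->
  (forall t : R, `|t| <= `|s| -> `|'D_e f (w + t *: e) - d| <= eps) ->
  `|f (w + s *: e) - f w - s * d| <= eps * `|s|.
Proof.
move=> df dle; pose g (t : R) := f (w + t *: e).
have dg (t : R) : `|t| <= `|s| -> is_derive t 1 g ('D_e f (w + t *: e)).
  by move=> ts; apply: is_derive_line; exact: df.
have g0 : f w = g 0 by rewrite /g scale0r addr0.
rewrite g0 -/(g s).
have [c cs ->] : exists2 c : R, `|c| <= `|s| &
    g s - g 0 = 'D_e f (w + c *: e) * s.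
  (* [MVT_segment] wants ordered endpoints, hence the two signs of [s]. *)
  have [s0|s0] := leP 0 s.
    have [||c] := @MVT_segment _ g (fun t => 'D_e f (w + t *: e)) 0 s s0.
    - by move=> x; rewrite in_itv /= => /andP[x0 xs]; apply: dg;
        rewrite !ger0_norm // ltW.
    - apply: derivable_within_continuous => x.
      by rewrite in_itv /= => /andP[x0 xs]; apply: (@ex_derive _ _ _ _ _ _ _ (dg _ _));
        rewrite !ger0_norm.
    - by rewrite in_itv /= subr0 => /andP[c0 cs] ->; exists c => //; rewrite !ger0_norm.
  have [||c] := @MVT_segment _ g (fun t => 'D_e f (w + t *: e)) s 0 (ltW s0).
  - by move=> x; rewrite in_itv /= => /andP[xs x0]; apply: dg;
      rewrite !ltr0_norm // lerN2 ltW.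
  - apply: derivable_within_continuous => x.
    by rewrite in_itv /= => /andP[xs x0]; apply: (@ex_derive _ _ _ _ _ _ _ (dg _ _));
      rewrite !ler0_norm ?lerN2 // ltW.
  - rewrite in_itv /= sub0r => /andP[cs c0] E; exists c.
      by rewrite !ler0_norm ?lerN2 // ltW.
    by rewrite -[LHS]opprB E mulrN opprK.
by rewrite [s * d]mulrC -mulrBl normrM ler_wpM2r // dle.
Qed.

(** Inductive step of the classical proof that continuous partial derivatives give
    differentiability: along the added direction [e] the derivative exists near [x] and is
    continuous at [x], while along [u] only the derivative at [x] is known. *)
Lemma is_deriveDdir (f : V -> R) (x u e : V) (a d : R) :
  is_derive x u f d -> (\forall z \near x, derivable f z e) ->
  {for x, continuous ('D_e f)} ->
  is_derive x (u + a *: e) f (d + a * 'D_e f x).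
Proof.
move=> [du dE] dfe cfe.
suff H : (fun h : R => h^-1 *: ((f \o shift x) (h *: (u + a *: e)) - f x)) @ 0^'
    --> d + a * 'D_e f x.
  by split; [apply/cvg_ex; eexists; exact: H | apply/cvg_lim].
(* Walk from [x] to the target along a broken path: first by [h *: u], then by [(h * a) *: e]. *)
have -> : (fun h : R => h^-1 *: ((f \o shift x) (h *: (u + a *: e)) - f x)) =
    (fun h : R => h^-1 *: ((f \o shift x) (h *: u) - f x)
     + h^-1 *: (f ((h *: u + x) + (h * a) *: e) - f (h *: u + x))).
  apply/funext => h /=; rewrite -scalerDr; congr (_ *: _).
  by rewrite scalerDr scalerA [X in f X]addrAC [RHS]addrC subrKA.
apply: cvgD; first by rewrite -dE; exact: du.
apply/cvgrPdist_le => eps eps0.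
(* The added 1 keeps the denominator positive when [a] is 0; likewise for [K0] below. *)
have a1 : 0 < `|a| + 1 by rewrite ltr_wpDl.
have e0 : 0 < eps / (`|a| + 1) by rewrite divr_gt0.
have : \forall z \near x, derivable f z e /\
    `|'D_e f x - 'D_e f z| <= eps / (`|a| + 1).
  by near=> z; split; near: z => //; move/cvgrPdist_le : cfe; exact.
move=> /nbhs_ballP[r /= r0 xr].
have K0 : 0 < `|u| + `|a| * `|e| + 1 by rewrite ltr_wpDl // addr_ge0 // mulr_ge0.
near=> h.
have h0 : h != 0 by near: h; exact: nbhs_dnbhs_neq.
have hr : `|h| * (`|u| + `|a| * `|e| + 1) < r.
  rewrite -ltr_pdivlMr //; near: h; apply: dnbhs0_lt; exact: divr_gt0.
(* The second leg of the path stays in the ball where the derivative along [e] is controlled. *)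
have inr t : `|t| <= `|h * a| -> ball x r (h *: u + x + t *: e).
  move=> th; rewrite -ball_normE /= [X in x - X]addrAC opprD addrCA subrr addr0.
  rewrite normrN.
  apply: le_lt_trans hr; apply: le_trans (ler_normD _ _) _.
  rewrite !normrZ -addrA mulrDr lerD2l mulrDr -[leLHS]addr0 lerD ?mulr1 //.
  by rewrite mulrA -normrM ler_wpM2r.
have sub : `|f ((h *: u + x) + (h * a) *: e) - f (h *: u + x) - h * a * 'D_e f x|
    <= eps / (`|a| + 1) * `|h * a|.
  by apply: derive_mean_value_le => t /inr /xr [] // _; rewrite distrC.
have -> : a * 'D_e f x - h^-1 *: (f ((h *: u + x) + (h * a) *: e) - f (h *: u + x))
    = - (h^-1 * (f ((h *: u + x) + (h * a) *: e) - f (h *: u + x) - h * a * 'D_e f x)).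
  by rewrite [h^-1 *: _]/(_ * _) [in RHS]mulrBr opprB !mulrA mulVf // mul1r.
rewrite normrN normrM normfV ler_pdivrMl ?normr_gt0 //.
apply: le_trans sub _; rewrite normrM mulrCA ler_wpM2l //.
by rewrite mulrAC ler_pdivrMr // ler_wpM2l ?lerDl // ltW.
Unshelve. all: by end_near. Qed.

End DirectionalDerivative.

(** * Calculus of [Ck_on] functions on open sets *)

Section ContinuouslyDifferentiable.
Variables (R : realType) (n : nat).

Lemma is_derive_coord (x v : 'rV[R]_n) (i : 'I_n) :
  is_derive x v (fun w : 'rV[R]_n => w 0 i) (v 0 i).
Proof.
suff H : (fun h : R => h^-1 *: (((fun w : 'rV[R]_n => w 0 i) \o shift x) (h *: v)
    - x 0 i)) @ 0^' --> v 0 i.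
  by split; [apply/cvg_ex; eexists; exact: H | apply/cvg_lim].
apply: cvg_near_cst; near=> h.
have h0 : h != 0 by near: h; exact: nbhs_dnbhs_neq.
by rewrite /= !mxE addrK [_ *: _]mulrA mulVf // mul1r.
Unshelve. all: by end_near. Qed.

Implicit Types (U : set 'rV[R]_n) (f g : 'rV[R]_n -> R).

(** Write [v] in the standard basis and add one coordinate direction at a time, starting from the
    direction 0. *)
Lemma is_derive_partials U f x v : open U -> Ck_on 1 U f -> U x ->
  is_derive x v f (\sum_i v 0 i * partial i f x).
Proof.
move=> oU [_ df] Ux; rewrite {1}[v]row_sum_delta.
elim/big_rec2: _ => [|i u d _ IH]; first exact: is_derive0.
rewrite [X in is_derive _ X]addrC [X in is_derive _ _ _ X]addrC.
have [di [ci _]] := df i; apply: is_deriveDdir => //; last exact: ci.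
by apply: filterS di _; exact: open_nbhs_nbhs.
Qed.

Lemma Ck_onS k U f : Ck_on k.+1 U f -> Ck_on k U f.
Proof.
elim: k f => [|k IH] f /= [cf df]; split=> // i.
by have [di Ci] := df i; split=> //; exact: IH.
Qed.

(** As [U] is open, equality on [U] is equality near each of its points, so the derivatives agree as
    well. *)
Lemma Ck_on_eq k U f g : open U -> (forall x, U x -> f x = g x) ->
  Ck_on k U f -> Ck_on k U g.
Proof.
move=> oU; elim: k f g => [|k IH] f g fg /= [cf df].
all: have nfg x : U x -> \forall z \near x, f z = g z by
  move=> Ux; apply: filterS fg _; exact: open_nbhs_nbhs.
all: have cg x : U x -> {for x, continuous g} by
  move=> Ux; suff: g @ x --> g x by []; rewrite -(fg _ Ux);
  apply: cvg_trans (cf x Ux); exact: near_eq_cvg (nfg _ Ux).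
  by split.
split=> // i; have [di Ci] := df i; split=> [x Ux|].
  exact: near_eq_derivable (nfg _ Ux) (di _ Ux).
by apply: IH Ci => x Ux; apply: near_eq_derive; exact: nfg.
Qed.

Lemma Ck_onD k U f g : open U -> Ck_on k U f -> Ck_on k U g ->
  Ck_on k U (fun x => f x + g x).
Proof.
move=> oU; elim: k f g => [|k IH] f g /= [cf df] [cg dg].
all: have cfg x : U x -> {for x, continuous (fun x => f x + g x)} by
  move=> Ux; exact: cvgD (cf x Ux) (cg x Ux).
  by split.
split=> // i; have [dfi Cfi] := df i; have [dgi Cgi] := dg i; split=> [x Ux|].
  by apply: derivableD; [exact: dfi|exact: dgi].
apply: Ck_on_eq oU _ (IH _ _ Cfi Cgi) => x Ux.
by rewrite /partial -deriveD //; [exact: dfi|exact: dgi].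
Qed.

Lemma Ck_onM k U f g : open U -> Ck_on k U f -> Ck_on k U g ->
  Ck_on k U (fun x => f x * g x).
Proof.
move=> oU; elim: k f g => [|k IH] f g Cf Cg; have [cf df] := Cf; have [cg dg] := Cg.
all: have cfg x : U x -> {for x, continuous (fun x => f x * g x)} by
  move=> Ux; exact: cvgM (cf x Ux) (cg x Ux).
  by split.
split=> // i; have [dfi Cfi] := df i; have [dgi Cgi] := dg i; split=> [x Ux|].
  by apply: derivableM; [exact: dfi|exact: dgi].
(* Leibniz's rule: in each product the undifferentiated factor is weakened by one order to fit the
   induction hypothesis. *)
apply: Ck_on_eq oU _ (Ck_onD oU (IH _ _ (Ck_onS Cf) Cgi) (IH _ _ (Ck_onS Cg) Cfi)).
move=> x Ux; rewrite /partial -[LHS]deriveM //; [exact: dfi|exact: dgi].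
Qed.

End ContinuouslyDifferentiable.

(** * Restriction of a function on the tangent bundle to one fibre *)

Section FibreRestriction.
Variables (R : realType) (n1 n2 : nat) (z : 'rV[R]_n1).

Lemma continuous_row_mx (y : 'rV[R]_n2) : {for y, continuous (row_mx z)}.
Proof.
move=> A [P nP sPA].
exists (fun i j => P i (rshift n1 j)).
  by move=> i j; have := nP i (rshift n1 j); rewrite row_mxEr.
move=> w Pw; apply: sPA => i j; case: (split_ordP j) => {}j ->.
(* The left block is the constant [z], so a neighbourhood is only used through its centre. *)
- rewrite row_mxEl; have := nP i (lshift n2 j); rewrite row_mxEl.
  exact: nbhs_singleton.
- by rewrite row_mxEr.
Qed.

Let quotE (f : 'rV[R]_(n1 + n2) -> R) (y : 'rV[R]_n2) (i : 'I_n2) :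
  (fun h : R => h^-1 *: (((fun w => f (row_mx z w)) \o shift y)
     (h *: delta_mx 0 i) - f (row_mx z y))) =
  (fun h : R => h^-1 *: ((f \o shift (row_mx z y))
     (h *: delta_mx 0 (rshift n1 i)) - f (row_mx z y))).
Proof.
apply/funext => h /=; congr (_ *: (f _ - _)).
rewrite -[delta_mx 0 (rshift _ _)]hsubmxK lsub_delta_r rsub_delta_r.
by rewrite scale_row_mx scaler0 add_row_mx add0r.
Qed.

(** Partial derivatives on the fibre over [z] are the partial derivatives of [f] in the last [n2]
    coordinates, because the difference quotients coincide. *)
Lemma Ck_on_row_mx k (U : set 'rV[R]_(n1 + n2)) f : Ck_on k U f ->
  Ck_on k [set y : 'rV[R]_n2 | U (row_mx z y)] (fun y => f (row_mx z y)).
Proof.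
elim: k f => [|k IH] f /= [cf df].
all: have cf' (y : 'rV[R]_n2) : U (row_mx z y) ->
    {for y, continuous (fun w => f (row_mx z w))} by
  move=> Uy; apply: continuous_comp; [exact: continuous_row_mx|exact: cf].
  by split.
split=> // i; have [di Ci] := df (rshift n1 i); split=> [y Uy|].
  by rewrite /derivable quotE; exact: di.
suff -> : partial i (fun y => f (row_mx z y)) =
    fun y => partial (rshift n1 i) f (row_mx z y) by exact: IH.
by apply/funext => y; rewrite /partial /derive quotE.
Qed.

End FibreRestriction.

(** * Euler's theorem for positively homogeneous functions *)

Section Euler.
Variables (R : realType) (n : nat).

Definition slit : set 'rV[R]_n := [set y | y != 0].

Lemma open_slit : open slit.
Proof.
rewrite (_ : slit = ~` [set 0]); last first.
  by apply/seteqP; split=> y /= /eqP.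
rewrite openC; apply/accessible_closed_set1/hausdorff_accessible.
exact: norm_hausdorff.
Qed.

Lemma near_slit (y : 'rV[R]_n) : y != 0 -> \forall w \near y, w != 0.
Proof. by move=> y0; exact: (open_nbhs_nbhs (conj open_slit y0)). Qed.

Definition homogeneous (k : nat) (f : 'rV[R]_n -> R) : Prop :=
  forall y l, y != 0 -> 0 < l -> f (l *: y) = l ^+ k * f y.

(** Differentiate [f (y + s *: y) = (1 + s) ^+ k * f y] at [s = 0]; the identity holds for [s] near
    0, where [1 + s] is positive. *)
Lemma euler k f (y : 'rV[R]_n) : Ck_on 1 slit f -> homogeneous k f -> y != 0 ->
  \sum_i y 0 i * partial i f y = k%:R * f y.
Proof.
move=> Cf hf y0; have D := is_derive_partials y open_slit Cf y0.
rewrite -[LHS](@derive_val _ _ _ _ _ _ _ D).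
have dy : derivable f (y + 0 *: y) y by rewrite scale0r addr0; case: D.
have := is_derive_line dy; rewrite scale0r addr0 => L.
have N : \forall s \near (0 : R), f (y + s *: y) = (1 + s) ^+ k * f y.
  near=> s; rewrite -[y in y + _]scale1r -scalerDl hf //.
  rewrite -ltrBlDl sub0r ltrNl; near: s.
  by apply: Nlt_nbhsl; rewrite oppr0 ltr01.
have L' := near_eq_is_derive N L.
rewrite -(@derive_val _ _ _ _ _ _ _ L').
have D1 : is_derive (0 : R) 1 (fun s : R => 1 + s) 1.
  apply: (is_derive_eq (is_deriveD (is_derive_cst (1 : R) _ _) (is_derive_id _ _))).
  by rewrite add0r.
have -> : (fun s : R => (1 + s) ^+ k * f y) =
    ((fun s : R => 1 + s) ^+ k : R -> R) * cst (f y).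
  by apply/funext => s; rewrite mulrfctE exprfctE.
rewrite (@derive_val _ _ _ _ _ _ _ (is_deriveM _ _)).
by rewrite scaler0 add0r /= addr0 expr1n mulr1 [_ *: 1]mulr1 mulrC.
Unshelve. all: by end_near. Qed.

(** Differentiate [f (l *: w) = l ^+ k.+1 * f w] in [w]: the inner scaling yields a factor [l],
    which is then cancelled. *)
Lemma partial_homogeneous k f i (y : 'rV[R]_n) l :
  Ck_on 1 slit f -> homogeneous k.+1 f ->
  y != 0 -> 0 < l -> partial i f (l *: y) = l ^+ k * partial i f y.
Proof.
move=> Cf hf y0 l0.
have ly0 : l *: y != 0 by rewrite scaler_eq0 negb_or gt_eqF.
have df : derivable f y (delta_mx 0 i) by have [_ /(_ i)[d _]] := Cf; exact: d.
have lN0 : l != 0 by rewrite gt_eqF.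
apply: (mulfI lN0); rewrite mulrA -exprS.
(* The factor [l] moves into the direction, since the derivative of a C^1 function is linear in
   it. *)
have -> : l * partial i f (l *: y) = 'D_(l *: delta_mx 0 i) f (l *: y).
  have [_ ->] := is_derive_partials (l *: delta_mx 0 i) open_slit Cf ly0.
  rewrite (bigD1 i) //= !mxE !eqxx mulr1 big1 ?addr0 // => j ji.
  by rewrite !mxE (negPf ji) andbF mulr0 mul0r.
rewrite -(derive_lin ( *:%R l)) /partial -deriveMl //; apply: near_eq_derive.
by apply: filterS (near_slit y0) => w w0 /=; rewrite hf.
Qed.

End Euler.

(** * Contractions of the fundamental and Cartan tensors with [y] *)

Section FibreIdentities.
Variables (R : realType) (n : nat) (L : 'rV[R]_n -> R) (y : 'rV[R]_n).
Let Phi w := L w ^+ 2.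
Hypotheses (CPhi : Ck_on 3 (@slit R n) Phi) (hPhi : homogeneous 2 Phi).
Hypothesis y0 : y != 0.

Let C1Phi : Ck_on 1 (@slit R n) Phi := Ck_onS (Ck_onS CPhi).

Let CdPhi b : Ck_on 2 (@slit R n) (partial b Phi).
Proof. by have [_ /(_ b)[]] := CPhi. Qed.

Let CddPhi a b : Ck_on 1 (@slit R n) (partial a (partial b Phi)).
Proof. by have [_ /(_ a)[]] := CdPhi b. Qed.

Lemma euler_partial b (w : 'rV[R]_n) : w != 0 ->
  \sum_a w 0 a * partial a (partial b Phi) w = partial b Phi w.
Proof.
move=> w0; have h : homogeneous 1 (partial b Phi).
  by move=> v l v0 l0; exact: partial_homogeneous C1Phi hPhi v0 l0.
by rewrite (euler (Ck_onS (CdPhi b)) h w0) mul1r.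
Qed.

Lemma fundamental_contract b :
  \sum_a y 0 a * fundamental_tensor L y a b = 2^-1 * partial b Phi y.
Proof.
rewrite -(euler_partial b y0) mulr_sumr; apply: eq_bigr => a _.
by rewrite mxE mulrCA.
Qed.

(** Euler's theorem is used twice, in degree 1 for the derivatives of [Phi] and in degree 2 for
    [Phi]; the latter cancels the factor 1/2. *)
Lemma fundamental_contract2 :
  \sum_a \sum_b y 0 a * y 0 b * fundamental_tensor L y a b = L y ^+ 2.
Proof.
rewrite exchange_big /=.
under eq_bigr do under eq_bigr do rewrite mulrAC mulrC.
under eq_bigr do rewrite -mulr_sumr fundamental_contract mulrCA.
by rewrite -mulr_sumr (euler C1Phi hPhi y0) mulrA mulVf ?mul1r // pnatr_eq0.
Qed.

Lemma cartan_tensorE a b c :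
  cartan_tensor L y a b c =
  2^-1 * (2^-1 * partial c (partial a (partial b Phi)) y).
Proof.
rewrite /cartan_tensor; congr (_ * _).
have [_ /(_ c)[/(_ _ y0) d _]] := CddPhi a b.
have -> : (fun w => fundamental_tensor L w a b) =
    2^-1 \*o partial a (partial b Phi) by apply/funext => w; rewrite mxE.
exact: deriveMl d.
Qed.

(* Differentiate Euler's identity for dPhi/dy^b in the direction c: this avoids
   the symmetry of the third derivatives. *)
Lemma cartan_contract b c : \sum_a y 0 a * cartan_tensor L y a b c = 0.
Proof.
under eq_bigr do rewrite cartan_tensorE mulrCA.
rewrite -mulr_sumr; under eq_bigr do rewrite mulrCA.
rewrite -mulr_sumr.
suff -> : \sum_a y 0 a * partial c (partial a (partial b Phi)) y = 0.
  by rewrite !mulr0.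
have dd a : is_derive y (delta_mx 0 c) (partial a (partial b Phi))
    (partial c (partial a (partial b Phi)) y).
  by apply: derivableP; have [_ /(_ c)[d _]] := CddPhi a b; exact: d.
have dS := is_derive_sum (fun a => is_deriveM (is_derive_coord y (delta_mx 0 c) a) (dd a)).
have N : \forall w \near y,
    (\sum_a ((fun w : 'rV[R]_n => w 0 a) * partial a (partial b Phi))) w
    = partial b Phi w.
  apply: filterS (near_slit y0) => w w0; rewrite fct_sumE -(euler_partial b w0).
  by apply: eq_bigr => a _; rewrite mulrfctE.
have := @derive_val _ _ _ _ _ _ _ (near_eq_is_derive N dS).
(* Leibniz's rule gives the wanted sum plus a sum over derivatives of the coordinates. There only
   [a = c] survives, and this term cancels the derivative of the right side of Euler's identity. *)
rewrite big_split /= [X in _ + X](bigD1 c) //= [X in _ + (_ + X)]big1; last first.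
  by move=> a ac; rewrite mxE (negPf ac) andbF [_ *: _]mulr0.
rewrite mxE !eqxx addr0 [_ *: 1]mulr1 => /eqP.
by rewrite -subr_eq0 opprD addrCA subrr addr0 oppr_eq0 => /eqP.
Qed.

End FibreIdentities.

(** * Partial derivatives of functions of one block of coordinates *)

Lemma partial_addl (R : realType) (n : nat) (f g : 'rV[R]_n -> R) (a : 'I_n)
    (x : 'rV[R]_n) :
  (forall h : R, g (h *: delta_mx 0 a + x) = g x) ->
  partial a (fun w => g w + f w) x = partial a f x.
Proof.
move=> gE; rewrite /partial /derive.
set q := (X in lim (X @ _)); set q' := (X in _ = lim (X @ _)).
suff -> : q = q' by []; apply/funext => h; rewrite /q /q' /=.
by rewrite gE opprD addrACA subrr add0r.
Qed.

Section LinearPullback.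
Variables (R : realType) (n m : nat) (pi : {linear 'rV[R]_n -> 'rV[R]_m}).
Variables (f : 'rV[R]_m -> R) (a : 'I_n) (x : 'rV[R]_n).

Lemma partial_lin (i : 'I_m) : pi (delta_mx 0 a) = delta_mx 0 i ->
  partial a (fun w => f (pi w)) x = partial i f (pi x).
Proof. by move=> ai; rewrite /partial (derive_lin pi f) ai. Qed.

Lemma partial_lin0 : pi (delta_mx 0 a) = 0 ->
  partial a (fun w => f (pi w)) x = 0.
Proof. by move=> a0; rewrite /partial (derive_lin pi f) a0 derive0. Qed.

End LinearPullback.

(* Contracting twice with y kills every term of the semi-C-reducibility formula
   but one, as I is orthogonal to y. *)
Lemma semi_C_contract (R : comNzRingType) (T : Type) (m : nat) (e : 'I_m -> T)
    (y : 'I_m -> R) (I : T -> R) (h : T -> T -> R) (s t : R) (a : T) :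
  (forall i j, s * (I (e i) * h (e j) a + I (e j) * h (e i) a
      + I a * h (e i) (e j)) + t * (I (e i) * I (e j) * I a) = 0) ->
  \sum_i y i * I (e i) = 0 ->
  s * I a * (\sum_i \sum_j y i * y j * h (e i) (e j)) = 0.
Proof.
move=> E yI.
(* Contraction over [j] leaves [K] multiplied by [I (e i)], so contraction over [i] removes it. *)
pose K := \sum_j y j * h (e j) a.
have Ei i : s * (I (e i) * K + I a * \sum_j y j * h (e i) (e j)) = 0.
  have : \sum_j y j * (s * (I (e i) * h (e j) a + I (e j) * h (e i) a
      + I a * h (e i) (e j)) + t * (I (e i) * I (e j) * I a)) = 0.
    by apply: big1 => j _; rewrite E mulr0.
  rewrite (eq_bigr (fun j => s * I (e i) * (y j * h (e j) a)
    + (s * h (e i) a + t * I (e i) * I a) * (y j * I (e j))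
    + s * I a * (y j * h (e i) (e j)))); last by move=> j _; ring.
  rewrite !big_split /= -!mulr_sumr yI mulr0 addr0 -/K => H.
  by rewrite mulrDr !mulrA.
have : \sum_i y i * (s * (I (e i) * K + I a * \sum_j y j * h (e i) (e j))) = 0.
  by apply: big1 => i _; rewrite Ei mulr0.
rewrite (eq_bigr (fun i => s * K * (y i * I (e i))
  + s * I a * (\sum_j y i * y j * h (e i) (e j)))); last first.
  move=> i _; under [in RHS]eq_bigr do rewrite -mulrA.
  rewrite -mulr_sumr; ring.
by rewrite big_split /= -!mulr_sumr yI mulr0 add0r.
Qed.

(** * Tensors of a metric whose square splits into two blocks *)

Section SplitMetric.
Variables (R : realType) (n n1 n2 : nat).
(** Projections and index embeddings stay abstract so that the results apply to the two factors of
    the product in either order. *)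
Variables (pi1 : {linear 'rV[R]_n -> 'rV[R]_n1}).
Variables (pi2 : {linear 'rV[R]_n -> 'rV[R]_n2}).
Variables (e1 : 'I_n1 -> 'I_n) (e2 : 'I_n2 -> 'I_n).
Hypothesis pi1e1 : forall i, pi1 (delta_mx 0 (e1 i)) = delta_mx 0 i.
Hypothesis pi1e2 : forall i, pi1 (delta_mx 0 (e2 i)) = 0.
Hypothesis pi2e1 : forall i, pi2 (delta_mx 0 (e1 i)) = 0.
Hypothesis pi2e2 : forall i, pi2 (delta_mx 0 (e2 i)) = delta_mx 0 i.
Hypothesis pi1E : forall Y i, pi1 Y 0 i = Y 0 (e1 i).
Hypothesis sum_e : forall F : 'I_n -> R,
  \sum_a F a = \sum_i F (e1 i) + \sum_i F (e2 i).
Hypothesis e_cover : forall a, (exists i, a = e1 i) \/ (exists i, a = e2 i).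
Variables (L : 'rV[R]_n -> R) (L1 : 'rV[R]_n1 -> R) (L2 : 'rV[R]_n2 -> R).
Hypothesis L_sq : forall Y, L Y ^+ 2 = L1 (pi1 Y) ^+ 2 + L2 (pi2 Y) ^+ 2.

Let Phi1 w := L1 w ^+ 2.
Let Phi2 w := L2 w ^+ 2.

Let partial_e1 i : partial (e1 i) (fun Y => L Y ^+ 2) =
  (fun Y => partial i Phi1 (pi1 Y)).
Proof.
rewrite (_ : (fun Y => L Y ^+ 2) = (fun Y => Phi2 (pi2 Y) + Phi1 (pi1 Y))).
  apply/funext => Y; rewrite (partial_addl (fun w => Phi1 (pi1 w)))
    ?(partial_lin Phi1 _ (pi1e1 i)) //.
  by move=> h; rewrite linearP pi2e1 scaler0 add0r.
by apply/funext => Y; rewrite L_sq addrC.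
Qed.

Let partial_e2 i : partial (e2 i) (fun Y => L Y ^+ 2) =
  (fun Y => partial i Phi2 (pi2 Y)).
Proof.
rewrite (_ : (fun Y => L Y ^+ 2) = (fun Y => Phi1 (pi1 Y) + Phi2 (pi2 Y))).
  apply/funext => Y; rewrite (partial_addl (fun w => Phi2 (pi2 w)))
    ?(partial_lin Phi2 _ (pi2e2 i)) //.
  by move=> h; rewrite linearP pi1e2 scaler0 add0r.
by apply/funext => Y; rewrite L_sq.
Qed.

Lemma fundamental_split11 Y i j :
  fundamental_tensor L Y (e1 i) (e1 j) = fundamental_tensor L1 (pi1 Y) i j.
Proof.
rewrite [LHS]mxE [RHS]mxE partial_e1.
by rewrite (partial_lin (partial j Phi1) Y (pi1e1 i)).
Qed.

Lemma fundamental_split12 Y i j : fundamental_tensor L Y (e1 i) (e2 j) = 0.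
Proof.
rewrite [LHS]mxE partial_e2.
by rewrite (partial_lin0 (partial j Phi2) Y (pi2e1 i)) mulr0.
Qed.

Let fundamental_split11_fun i j :
  (fun Y => fundamental_tensor L Y (e1 i) (e1 j)) =
  (fun Y => fundamental_tensor L1 (pi1 Y) i j).
Proof. by apply/funext => Y; rewrite fundamental_split11. Qed.

Lemma cartan_split111 Y i j k :
  cartan_tensor L Y (e1 i) (e1 j) (e1 k) = cartan_tensor L1 (pi1 Y) i j k.
Proof.
rewrite /cartan_tensor fundamental_split11_fun.
by rewrite (partial_lin (fun w => fundamental_tensor L1 w i j) Y (pi1e1 k)).
Qed.

Lemma cartan_split112 Y i j k : cartan_tensor L Y (e1 i) (e1 j) (e2 k) = 0.
Proof.
rewrite /cartan_tensor fundamental_split11_fun.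
by rewrite (partial_lin0 (fun w => fundamental_tensor L1 w i j) Y (pi1e2 k)) mulr0.
Qed.

Lemma cartan_split12 Y i j c : cartan_tensor L Y (e1 i) (e2 j) c = 0.
Proof.
rewrite /cartan_tensor.
have -> : (fun w => fundamental_tensor L w (e1 i) (e2 j)) = cst 0.
  by apply/funext => w; rewrite fundamental_split12.
by rewrite /partial derive_cst mulr0.
Qed.

Lemma covector_split Y i : covector L Y (e1 i) = covector L1 (pi1 Y) i.
Proof.
rewrite /covector sum_e [X in _ + X]big1 ?addr0; last first.
  by move=> j _; rewrite fundamental_split12 mul0r.
by apply: eq_bigr => j _; rewrite fundamental_split11 pi1E.
Qed.

Variable Y : 'rV[R]_n.
Hypothesis C1 : Ck_on 3 (@slit R n1) (fun w => L1 w ^+ 2).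
Hypothesis h1 : homogeneous 2 (fun w => L1 w ^+ 2).
Hypothesis Y1 : pi1 Y != 0.

(** The contraction already vanishes before the trace: mixed components are 0, and on the first
    block Euler's identity applies. *)
Lemma mean_cartan_contract : \sum_i pi1 Y 0 i * mean_cartan L Y (e1 i) = 0.
Proof.
have cartan0 b c : \sum_i pi1 Y 0 i * cartan_tensor L Y (e1 i) b c = 0.
  have [[j ->]|[j ->]] := e_cover b; last first.
    by apply: big1 => i _; rewrite cartan_split12 mulr0.
  have [[k ->]|[k ->]] := e_cover c; last first.
    by apply: big1 => i _; rewrite cartan_split112 mulr0.
  under eq_bigr do rewrite cartan_split111.
  exact: cartan_contract.
rewrite /mean_cartan; under eq_bigr do rewrite mulr_sumr.
rewrite exchange_big big1 //= => b _.
under eq_bigr do rewrite mulr_sumr.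
rewrite exchange_big big1 //= => c _.
under eq_bigr do rewrite mulrCA.
by rewrite -mulr_sumr cartan0 mulr0.
Qed.

Lemma angular_contract :
  \sum_i \sum_j pi1 Y 0 i * pi1 Y 0 j * angular_metric L Y (e1 i) (e1 j) =
  L1 (pi1 Y) ^+ 2 - (L Y ^+ 2)^-1 * (L1 (pi1 Y) ^+ 2) ^+ 2.
Proof.
have cov : \sum_i pi1 Y 0 i * covector L1 (pi1 Y) i = L1 (pi1 Y) ^+ 2.
  rewrite -(fundamental_contract2 C1 h1 Y1); apply: eq_bigr => i _.
  by rewrite mulr_sumr; apply: eq_bigr => j _; rewrite mulrAC mulrA.
rewrite /angular_metric.
under eq_bigr do under eq_bigr do
  rewrite fundamental_split11 !covector_split mulrBr.
under eq_bigr do rewrite sumrB.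
rewrite sumrB fundamental_contract2 //; congr (_ - _).
rewrite -cov [(\sum_i _) ^+ 2]expr2 mulr_suml mulr_sumr; apply: eq_bigr => i _.
rewrite mulrA mulr_sumr; apply: eq_bigr => j _.
by rewrite mulrCA mulrACA mulrA.
Qed.

(** Here [s] and [t] stand for p/(n+1) and q/C^2. The components with indices in blocks 1, 1, 2
    vanish, so the double contraction leaves [s] times the mean Cartan component times a nonzero
    factor. *)
Lemma semi_C_split (s t : R) :
  0 < L1 (pi1 Y) ^+ 2 -> 0 < L2 (pi2 Y) ^+ 2 ->
  (forall a b c : 'I_n,
     let I_ := mean_cartan L Y in let h_ := angular_metric L Y in
     cartan_tensor L Y a b c =
       s * (I_ a * h_ b c + I_ b * h_ a c + I_ c * h_ a b)
       + t * (I_ a * I_ b * I_ c)) ->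
  forall k, s * mean_cartan L Y (e2 k) = 0.
Proof.
move=> L1gt0 L2gt0 E k.
have := semi_C_contract (e := e1) (y := fun i => pi1 Y 0 i) (I := mean_cartan L Y)
  (h := angular_metric L Y) (s := s) (t := t) (a := e2 k).
move=> /(_ _ mean_cartan_contract); rewrite angular_contract.
set H := _ - _.
have H0 : H != 0.
  have Lgt0 : 0 < L Y ^+ 2 by rewrite L_sq addr_gt0.
  (* With A and B the two summands of the squared metric, A - A^2/(A + B) = AB/(A + B). *)
  suff -> : H = (L Y ^+ 2)^-1 * (L1 (pi1 Y) ^+ 2 * L2 (pi2 Y) ^+ 2).
    by rewrite gt_eqF // mulr_gt0 ?invr_gt0 // mulr_gt0.
  apply: (mulfI (lt0r_neq0 Lgt0)).
  rewrite /H mulrBr !mulrA divff ?lt0r_neq0 // !mul1r L_sq; ring.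
move=> P; apply: (mulIf H0); rewrite mul0r; apply: P => i j.
by rewrite -E cartan_split112.
Qed.

End SplitMetric.

(** * A Finsler metric on a single fibre *)

Section FinslerFibre.
Variables (R : realType) (n : nat) (M : manifold R n) (F : tangent_fun M).
Hypothesis hF : finsler_metric F.
Variables (c : chart M) (x : M).
Hypothesis dx : dom c x.

(** The factor [r] makes room for the twisting function, which is constant on a fibre. *)
Lemma finsler_fibre_Ck k (r : R) :
  Ck_on k (@slit R n) (fun y => (r * F c x y) ^+ 2).
Proof.
have CF : Ck_on k (@slit R n) (F c x).
  have [/(_ c k) H _ _] := hF.
  have := Ck_on_row_mx (Defs.coord c x) H.
  have -> : (fun y => F c (Defs.inv c (lsubmx (row_mx (Defs.coord c x) y)))
               (rsubmx (row_mx (Defs.coord c x) y))) = F c x.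
    by apply/funext => y; rewrite row_mxKl row_mxKr coordK.
  by apply: Ck_on_sub => y y0 /=; rewrite row_mxKl row_mxKr; split=> //; exists x.
have CrF := Ck_onM (@open_slit R n) (Ck_on_cst k _ r) CF.
exact: (Ck_onM (@open_slit R n) CrF CrF).
Qed.

Lemma finsler_fibre_homogeneous (r : R) :
  homogeneous 2 (fun y => (r * F c x y) ^+ 2).
Proof.
by move=> y l y0 l0; have [_ -> // _] := hF; rewrite mulrCA exprMn.
Qed.

(** Positive definiteness is evaluated at the vector [y] itself, where g(y, y) equals F^2. *)
Lemma finsler_fibre_sq_gt0 (y : 'rV[R]_n) : y != 0 -> 0 < F c x y ^+ 2.
Proof.
move=> y0; have [_ _ /(_ c x y y dx y0 y0)] := hF.
have E : (fun y => (1 * F c x y) ^+ 2) = (fun y => F c x y ^+ 2).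
  by apply/funext => w; rewrite mul1r.
have C := finsler_fibre_Ck 3 1; have h := finsler_fibre_homogeneous 1.
rewrite E in C h.
rewrite -(fundamental_contract2 C h y0) exchange_big mxE; congr (_ < _).
apply: eq_bigr => b _; rewrite [_^T _ _]mxE [X in X * _]mxE mulr_suml.
by apply: eq_bigr => a _; rewrite mulrAC.
Qed.

End FinslerFibre.

(** * Vanishing of p on the twisted product *)

Theorem theorem2 (R : realType) (n1 n2 : nat)
  (M1 : manifold R n1) (M2 : manifold R n2)
  (F1 : tangent_fun M1) (F2 : tangent_fun M2)
  (hF1 : finsler_metric F1) (hF2 : finsler_metric F2)
  (f : prod_manifold M1 M2 -> R)
  (f_gt0 : forall x : prod_manifold M1 M2, 0 < f x)
  (f_smooth : smooth_fun f)
  (A : chart (prod_manifold M1 M2) -> prod_manifold M1 M2 ->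
       set 'rV[R]_(n1 + n2))
  (hA : forall (c : chart (prod_manifold M1 M2)) (x : prod_manifold M1 M2),
       A c x `<=` split_slit) :
  semi_C_reducible_on A (twisted_metric F1 F2 f) ->
  C2_like_on A (twisted_metric F1 F2 f).
Proof.
move=> [C2_neq0 [p [q pq]]] c x Y dx AY.
have C2 := C2_neq0 _ _ _ dx AY; split=> //.
have [pq1 E] := pq _ _ _ dx AY.
have [Y1 Y2] := hA _ _ _ AY; have [d1 d2] := dx.
(* The factor 1 gives [L1] the same shape as [L2], so the fibre lemmas serve both. *)
pose L1 y := 1 * F1 c.1 x.1 y; pose L2 v := f x * F2 c.2 x.2 v.
set L := twisted_metric F1 F2 f c x in C2 E *.
have L_sq w : L w ^+ 2 = L1 (lsubmx w) ^+ 2 + L2 (rsubmx w) ^+ 2.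
  rewrite /L /= /twisted_val sqr_sqrtr; first by rewrite /L1 /L2 mul1r exprMn.
  exact: (addr_ge0 (sqr_ge0 _) (mulr_ge0 (sqr_ge0 _) (sqr_ge0 _))).
have L1gt0 : 0 < L1 (lsubmx Y) ^+ 2.
  by rewrite /L1 mul1r (finsler_fibre_sq_gt0 hF1).
have L2gt0 : 0 < L2 (rsubmx Y) ^+ 2.
  rewrite /L2 exprMn.
  exact: mulr_gt0 (exprn_gt0 _ (f_gt0 x)) (finsler_fibre_sq_gt0 hF2 d2 Y2).
have cover (a : 'I_(n1 + n2)) :
    (exists i, a = lshift n2 i) \/ (exists i, a = rshift n1 i).
  by case: (split_ordP a) => i ->; [left|right]; exists i.
set s := p c x Y / _ in E; set t := q c x Y / _ in E.
have s_r : forall k, s * mean_cartan L Y (rshift n1 k) = 0.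
  refine (@semi_C_split _ _ _ _ lsubmx rsubmx (@lshift n1 n2) (@rshift n1 n2)
    (@lsub_delta_l _ _ _) (@lsub_delta_r _ _ _) (@rsub_delta_l _ _ _)
    (@rsub_delta_r _ _ _) _ _ cover L L1 L2 L_sq Y
    (finsler_fibre_Ck hF1 d1 3 1) (finsler_fibre_homogeneous hF1 d1 1) Y1
    s t L1gt0 L2gt0 E).
  - by move=> w i; rewrite mxE.
  - by move=> G; rewrite big_split_ord.
(* The same argument with the two factors exchanged. *)
have s_l : forall k, s * mean_cartan L Y (lshift n2 k) = 0.
  refine (@semi_C_split _ _ _ _ rsubmx lsubmx (@rshift n1 n2) (@lshift n1 n2)
    (@rsub_delta_r _ _ _) (@rsub_delta_l _ _ _) (@lsub_delta_r _ _ _)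
    (@lsub_delta_l _ _ _) _ _ _ L L2 L1 _ Y
    (finsler_fibre_Ck hF2 d2 3 (f x)) (finsler_fibre_homogeneous hF2 d2 (f x)) Y2
    s t L2gt0 L1gt0 E).
  - by move=> w i; rewrite mxE.
  - by move=> G; rewrite big_split_ord addrC.
  - by move=> a; have [] := cover a; [right|left].
  - by move=> w; rewrite L_sq addrC.
(* Otherwise every component of the mean Cartan tensor would vanish, and with it C^2. *)
have s0 : s = 0.
  apply: contra_neq_eq C2 => sN0.
  have I0 a : mean_cartan L Y a = 0.
    by apply: (mulfI sN0); rewrite mulr0; have [[i ->]|[i ->]] := cover a.
  rewrite /mean_cartan_sq big1 // => a _; rewrite big1 // => b _.
  by rewrite I0 mul0r mulr0.
have p0 : p c x Y = 0.
  by apply/eqP; move/eqP: s0; rewrite mulf_eq0 invr_eq0 pnatr_eq0 orbF.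
move=> i j k /=; have /= -> := E i j k; rewrite s0 mul0r add0r /t.
by move: pq1; rewrite p0 add0r => ->; rewrite div1r.
Qed.
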